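(* For every integer $m\ge 1$, the following identity holds in $\mathbb{Z}[a_0,\ldots,a_m]$: $$H_{1,1,2}(m) = -2a_0^2\, D(m,1) - 2 (a_0+a_1)\,D(m,0).$$
   Context: Let $m\ge 1$ and let $a_0,\ldots,a_m$ be independent commuting variables over $\mathbb{Z}$; put $a_l:=0$ for every integer $l\notin\{0,\ldots,m\}$. Let $t,U$ be further commuting variables. The determinant of a $0\times 0$ matrix is $1$. Let $\mathcal M_2$ be the $(m+1)\times(m+1)$ matrix over $\mathbb{Z}[a_0,\ldots,a_m][t]$ with $(i,j)$-th entry $a_{2j-i}\,t^2-2a_{2j-i-1}\,t+a_{2j-i-2}$ ($1\le i,j\le m+1$). The polynomials $H_{i,j,2}(m)\in\mathbb{Z}[a_0,\ldots,a_m]$ are defined by $$\det(\mathcal M_2-U I_{m+1})=\sum_{i=0}^{m+1}\sum_{j=0}^{2(m+1-i)}H_{i,j,2}(m)\,t^j(-U)^{i}.$$ Let $\mathcal M_0$ be the $(m-1)\times(m-1)$ matrix over $\mathbb{Z}[a_0,\ldots,a_m]$ with $(i,j)$-th entry $a_{2j-i}$ ($1\le i,j\le m-1$). The polynomials $D(m,i)\in\mathbb{Z}[a_0,\ldots,a_m]$ are defined for $i\in\{0,\ldots,m-1\}$ by $$\det(\mathcal M_0-U I_{m-1})=\sum_{i=0}^{m-1}D(m,i)\,(-U)^{i},$$ and $D(m,i):=0$ for $i\notin\{0,\ldots,m-1\}$. *)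

(* Defs.v *)
From mathcomp Require Import all_boot all_order all_fingroup all_algebra.
From mathcomp Require Import zify.
From mathcomp Require Import mpoly.

Set Implicit Arguments.
Unset Strict Implicit.
Unset Printing Implicit Defensive.

Import GRing.Theory.
Local Open Scope ring_scope.

Notation coefRing m := {mpoly int[m.+1]}.

Definition avar (m : nat) (l : int) : coefRing m :=
  match l with
  | Posz k => if insub k is Some i then 'X_(i : 'I_m.+1) else 0
  | Negz _ => 0
  end.

(* The variable 'X of the polynomial ring is t.  Ordinals start at 0, so the
   1-based row and column indices are i.+1 and j.+1. *)
Definition M2 (m : nat) : 'M[{poly coefRing m}]_m.+1 :=
  \matrix_(i, j)
    let r := i.+1%:Z in let c := j.+1%:Z in
    ((avar m (2 * c - r))%:P * 'X^2
     - (2 * avar m (2 * c - r - 1))%:P * 'X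
     + (avar m (2 * c - r - 2))%:P).

Definition M0 (m : nat) : 'M[coefRing m]_m.-1 :=
  \matrix_(i, j)
    let r := i.+1%:Z in let c := j.+1%:Z in avar m (2 * c - r).

(* det (A - U I), the outermost 'X being U. *)
Definition detU (R : comNzRingType) (n : nat) (A : 'M[R]_n) : {poly R} :=
  \det (map_mx polyC A - 'X%:M).

(* H2 m i j is the coefficient of t^j (-U)^i. *)
Definition H2 (m i j : nat) : coefRing m := (-1) ^+ i * ((detU (M2 m))`_i)`_j.

(* Defined for all i; it vanishes for i >= m by [D_out]. *)
Definition D (m i : nat) : coefRing m := (-1) ^+ i * (detU (M0 m))`_i.

Definition bounded (R : nzRingType) (k : nat) (p : {poly {poly R}}) :=
  forall i j, (2 * k < 2 * i + j)%N -> (p`_i)`_j = 0.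

Lemma bounded1 (R : nzRingType) : bounded 0 (1 : {poly {poly R}}).
Proof.
move=> i j h; rewrite coef1; case: i h => [|i] h /=; last by rewrite coef0.
by rewrite coef1; case: j h.
Qed.

Lemma boundedM (R : nzRingType) k l (p q : {poly {poly R}}) :
  bounded k p -> bounded l q -> bounded (k + l) (p * q).
Proof.
move=> hp hq i j h; rewrite coefM coef_sum big1 // => a _.
rewrite coefM big1 // => b _.
case: (ltnP (2 * k) (2 * a + b)) => hab; first by rewrite hp // mul0r.
by rewrite hq ?mulr0 //; have := ltn_ord a; have := ltn_ord b; lia.
Qed.

Lemma bounded_entry (m : nat) (i j : 'I_m.+1) :
  bounded 1 ((map_mx polyC (M2 m) - 'X%:M) i j).
Proof.
move=> a b h; rewrite !mxE coefB coefC coefMn coefX.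
have hX : (((a == 1%N)%:R : {poly coefRing m}) *+ (i == j))`_b = 0.
  rewrite coefMn; case: eqP => [ea|_]; last by rewrite coef0 mul0rn.
  by rewrite coef1 (_ : b == 0%N = false) ?mul0rn //; lia.
rewrite coefB hX subr0; case: eqP => [ea|_]; last by rewrite coef0.
rewrite !(coefD, coefN, coefCM) coefXn coefX coefC.
have [-> -> ->] : [/\ (b == 2%N) = false, (b == 1%N) = false & (b == 0%N) = false].
  by split; lia.
by rewrite !mulr0 subr0 addr0.
Qed.

Lemma bounded_det (m : nat) : bounded m.+1 (detU (M2 m)).
Proof.
move=> a b h; rewrite /detU /determinant coef_sum coef_sum big1 // => s _.
have hP : bounded m.+1 (\prod_i (map_mx polyC (M2 m) - 'X%:M) i (s i)).
  suff : bounded (\sum_(i : 'I_m.+1) 1)%N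
           (\prod_i (map_mx polyC (M2 m) - 'X%:M) i (s i)).
    by rewrite sum1_card card_ord.
  elim/big_rec2: _ => [|i k p _ IH]; first exact: bounded1.
  by apply: boundedM IH; apply: bounded_entry.
rewrite -signr_odd; case: odd; rewrite ?expr1 ?expr0 ?mulN1r ?mul1r ?coefN ?hP ?oppr0 //.
Qed.

Lemma size_detU (R : comNzRingType) n (A : 'M[R]_n) : (size (detU A) <= n.+1)%N.
Proof.
have -> : detU A = (-1) ^+ n * char_poly A.
  by rewrite /char_poly -detZ scaleN1r opprB.
by rewrite -signr_odd; case: odd;
  rewrite ?expr1 ?expr0 ?mulN1r ?mul1r ?size_polyN size_char_poly.
Qed.

Lemma D_out (m i : nat) : (1 <= m)%N -> (m <= i)%N -> D m i = 0.
Proof.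
move=> hm hi; rewrite /D nth_default ?mulr0 //.
by apply: leq_trans (size_detU _) _; rewrite prednK.
Qed.

Lemma detU_expansion (R : comNzRingType) n (A : 'M[R]_n) :
  detU A = \sum_(i < n.+1) ((-1) ^+ i * (detU A)`_i)%:P * (- 'X) ^+ i.
Proof.
have {1}-> : detU A = \poly_(i < n.+1) (detU A)`_i.
  apply/polyP => k; rewrite coef_poly; case: ltnP => // h.
  by rewrite nth_default // (leq_trans (size_detU A)).
rewrite poly_def; apply: eq_bigr => i _.
rewrite (exprNn 'X) -mul_polyC polyCM polyC_exp polyCN polyC1 mulrACA.
by rewrite -expr2 sqrr_sign mul1r.
Qed.

Lemma D_expansion (m : nat) : (1 <= m)%N ->
  detU (M0 m) = \sum_(i < m) (D m i)%:P * (- 'X) ^+ i.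
Proof. by move=> hm; rewrite [LHS]detU_expansion prednK. Qed.

Lemma H2_expansion (m : nat) :
  detU (M2 m) =
  \sum_(i < m.+2) \sum_(j < (2 * (m.+1 - i)).+1)
    ((H2 m i j)%:P * 'X^j)%:P * (- 'X) ^+ i.
Proof.
rewrite [LHS]detU_expansion; apply: eq_bigr => i _.
rewrite -mulr_suml -rmorph_sum; congr (_%:P * _); apply/polyP => k.
transitivity (H2 m i k).
  rewrite /H2 -!(signr_odd _ i); case: odd;
  by rewrite ?expr1 ?expr0 ?mulN1r ?mul1r ?coefN.
rewrite coef_sum; case: (ltnP k (2 * (m.+1 - i)).+1) => hk.
  rewrite (bigD1 (Ordinal hk)) //= coefCM coefXn eqxx mulr1 big1 ?addr0 // => j.
  rewrite -val_eqE /= => hj; rewrite coefCM coefXn eq_sym (negPf hj) mulr0 //.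
rewrite /H2 bounded_det ?mulr0; last by have := ltn_ord i; lia.
rewrite big1 // => j _; rewrite coefCM coefXn.
by rewrite (_ : k == j = false) ?mulr0 //; have := ltn_ord j; lia.
Qed.

(* Main.v *)
Require Import Defs.
From mathcomp Require Import all_boot all_order all_algebra.
From mathcomp Require Import mpoly.
From mathcomp Require Import zify ring.

Import GRing.Theory.
Local Open Scope ring_scope.

(** Only the terms of degree at most 1 in [t] matter, so everything is computed
    modulo [t^2].  There the first column of [M2 - U] is [(-2 a_0 t - U, 0, ..., 0)],
    which leaves the [m x m] block [P] with entries [a_(2j-i-1) - 2 t a_(2j-i)].
    At [t = 0] its first column is [(a_0, 0, ..., 0)] and the remaining block is
    [M0]; this gives the [U]-linear term of [det (P - U)].  For the [t]-linear
    term of [det P], adding [2 t] times row [i - 1] to row [i] telescopes modulo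
    [t^2] and again clears the first column, leaving
    [det P = (a_0 - 2 a_1 t) det M0]. *)

Definition cmod {R : comNzRingType} (c x y : R) := exists z, x = y + c * z.

Lemma cmod_refl (R : comNzRingType) (c x : R) : cmod c x x.
Proof. by exists 0; rewrite mulr0 addr0. Qed.

Lemma cmodD (R : comNzRingType) (c x y x' y' : R) :
  cmod c x y -> cmod c x' y' -> cmod c (x + x') (y + y').
Proof. by move=> [z ->] [z' ->]; exists (z + z'); ring. Qed.

Lemma cmodM (R : comNzRingType) (c x y x' y' : R) :
  cmod c x y -> cmod c x' y' -> cmod c (x * x') (y * y').
Proof.
by move=> [z ->] [z' ->]; exists (y * z' + y' * z + c * z * z'); ring.
Qed.

Lemma cmod_det (R : comNzRingType) (c : R) n (A B : 'M[R]_n) :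
  (forall i j, cmod c (A i j) (B i j)) -> cmod c (\det A) (\det B).
Proof.
move=> AB; rewrite /determinant.
elim/big_ind2: _ => [|x y x' y'|s _]; first exact: cmod_refl.
  exact: cmodD.
apply: cmodM; first exact: cmod_refl.
elim/big_ind2: _ => [|x y x' y'|i _]; [exact: cmod_refl | exact: cmodM | exact: AB].
Qed.

Lemma coef_cmodXn (R : comNzRingType) (n i : nat) (p q : {poly R}) :
  (i < n)%N -> cmod 'X^n p q -> p`_i = q`_i.
Proof. by move=> lt_in [z ->]; rewrite coefD coefXnM lt_in addr0. Qed.

(** In [detU] the outer variable is U, so reducing modulo t^n means reducing modulo the constant
    [('X^n)%:P]. *)
Lemma coef_cmodCXn (R : comNzRingType) (n i j : nat) (p q : {poly {poly R}}) :
  (j < n)%N -> cmod ('X^n)%:P p q -> p`_i`_j = q`_i`_j.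
Proof. by move=> lt_jn [z ->]; rewrite coefD coefCM coefD coefXnM lt_jn addr0. Qed.

Lemma det_col0 (R : comNzRingType) n (A : 'M[R]_n.+1) :
  (forall i, A (lift ord0 i) ord0 = 0) ->
  \det A = A ord0 ord0 * \det (row' ord0 (col' ord0 A)).
Proof.
move=> A0; rewrite (expand_det_col _ ord0) big_ord_recl big1 => [|i _].
  by rewrite addr0 /cofactor expr0 mul1r.
by rewrite A0 mul0r.
Qed.

Lemma detU_col0 (R : comNzRingType) n (A : 'M[R]_n.+1) :
  (forall i, A (lift ord0 i) ord0 = 0) ->
  detU A = ((A ord0 ord0)%:P - 'X) * detU (row' ord0 (col' ord0 A)).
Proof.
move=> A0; rewrite /detU det_col0 => [|i]; last by rewrite !mxE A0 /= subr0.
rewrite !mxE /=; congr (_ * \det _); apply/matrixP => i j.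
by rewrite !mxE (inj_eq lift_inj).
Qed.

Lemma detU_coef0 (R : comNzRingType) n (A : 'M[R]_n) : (detU A)`_0 = \det A.
Proof.
rewrite -horner_coef0 -[LHS]/(horner_eval 0 (detU A)) -det_map_mx.
congr (\det _); apply/matrixP => i j.
by rewrite !mxE /= /horner_eval !hornerE hornerMn hornerX mul0rn subr0.
Qed.

Lemma map_detU (R S : comNzRingType) (f : {rmorphism R -> S}) n (A : 'M[R]_n) :
  map_poly f (detU A) = detU (map_mx f A).
Proof.
rewrite /detU -det_map_mx; congr (\det _); apply/matrixP => i j.
by rewrite !mxE rmorphB rmorphMn /= map_polyC map_polyX.
Qed.

Section Decimation.
Variables (R : comNzRingType) (a : int -> R).
Hypothesis a_neg : forall k, a (Negz k) = 0.

Lemma a_lt0 (l : int) : l < 0 -> a l = 0.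
Proof. by case: l => // k _. Qed.

Definition decim n : 'M[R]_n := \matrix_(i, j) a (2 * j.+1%:Z - i.+1%:Z).

(** The block P. Ordinals start at 0, so the subscripts 2j-i-1 and 2j-i become 2j-i and 2j-i+1. *)
Definition shift_decim n : 'M[{poly R}]_n :=
  \matrix_(i, j) ((a (2 * j%:Z - i%:Z))%:P
                  - (2 * a (2 * j%:Z - i%:Z + 1))%:P * 'X).

(** At t = 0 column 0 has entries a_(-i), zero for i > 0; raising both indices by one turns 2j-i
    into the subscript in [decim]. *)
Lemma detU_shift_decim0 n :
  map_poly (horner_eval 0) (detU (shift_decim n.+1)) =
  ((a 0)%:P - 'X) * detU (decim n).
Proof.
rewrite map_detU detU_col0 => [|i]; rewrite !mxE /= /horner_eval !hornerE subr0.
  congr (_ * _); congr detU; apply/matrixP => i j.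
  rewrite !mxE /= /horner_eval !hornerE subr0.
  congr (a _); rewrite /bump /=; lia.
by apply: a_lt0; rewrite /bump /=; lia.
Qed.

Lemma det_shift_decim_mod n :
  cmod 'X^2 (\det (shift_decim n.+1))
    (((a 0)%:P - (2 * a 1)%:P * 'X) * (\det (decim n))%:P).
Proof.
(* Left multiplication by the unitriangular [L] adds 2t times row i-1 to row i. *)
pose L : 'M[{poly R}]_n.+1 :=
  \matrix_(i, j) ((i == j)%:R + (2%:P * 'X) *+ (i == j.+1 :> nat)).
(* The outcome of these row operations modulo t^2: only row 0, which has no row above it, keeps its
   t-term. *)
pose Q : 'M[{poly R}]_n.+1 :=
  \matrix_(i, j) ((a (2 * j%:Z - i%:Z))%:P
                  - ((2 * a (2 * j%:Z - i%:Z + 1))%:P * 'X) *+ (i == ord0)).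
have detL : \det L = 1.
  rewrite det_trig; last first.
    apply/is_trig_mxP => i j ltij; rewrite mxE.
    have -> : (i == j) = false by apply/eqP => eij; move: ltij; rewrite eij ltnn.
    by rewrite (_ : (_ == _) = false) ?addr0 //; lia.
  by rewrite big1 // => i _; rewrite mxE eqxx (_ : (_ == _) = false) ?addr0 //; lia.
have detQ : \det Q =
    ((a 0)%:P - (2 * a 1)%:P * 'X) * (\det (decim n))%:P.
  rewrite det_col0 => [|i]; last first.
    by rewrite !mxE /= subr0 a_lt0 //= /bump /=; lia.
  rewrite !mxE /= -det_map_mx; congr (_ * \det _); apply/matrixP => i j.
  rewrite !mxE /= subr0; congr (a _)%:P; rewrite /bump /=; lia.
rewrite -detQ -[\det (shift_decim _)]mul1r -detL -det_mulmx.
apply: cmod_det => i j; rewrite mxE.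
under eq_bigr do rewrite mxE mulrDl.
rewrite big_split /= (bigD1 i) //= eqxx mul1r big1 ?addr0; last first.
  by move=> k; rewrite eq_sym => /negPf ->; rewrite mul0r.
case: (unliftP ord0 i) => [k|] ->; last first.
  rewrite big1 => [|l _]; last by rewrite mul0r.
  by rewrite addr0 !mxE; apply: cmod_refl.
rewrite (bigD1 (widen_ord (leqnSn n) k)) //= big1 ?addr0; last first.
  move=> l; rewrite -val_eqE /= => /negPf lk.
  by rewrite /bump /= eqSS eq_sym lk mul0r.
rewrite !mxE /= /bump /= eqxx subr0 !add1n.
rewrite (_ : 2 * j%:Z - k.+1%:Z + 1 = 2 * j%:Z - k%:Z); last by lia.
(* The t-terms of row k+1 and of 2t times row k cancel; what is left is 2t times the t-term of row
   k. *)
exists (- (4 * a (2 * j%:Z - k%:Z + 1))%:P).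
by rewrite mulr1n !polyCM !polyC_natr; ring.
Qed.

Definition M2_gen n : 'M[{poly R}]_n :=
  \matrix_(i, j)
    ((a (2 * j.+1%:Z - i.+1%:Z))%:P * 'X^2
     - (2 * a (2 * j.+1%:Z - i.+1%:Z - 1))%:P * 'X
     + (a (2 * j.+1%:Z - i.+1%:Z - 2))%:P).

Lemma detU_M2_mod n :
  cmod ('X^2)%:P (detU (M2_gen n.+1))
    ((- ((2 * a 0)%:P * 'X)%:P - 'X) * detU (shift_decim n)).
Proof.
(* [M2_gen] without its t^2 terms. In column 0 the subscripts are -i-1 and -i, so only -2 a_0 t in
   row 0 survives. *)
pose N : 'M[{poly R}]_n.+1 :=
  \matrix_(i, j)
    ((a (2 * j.+1%:Z - i.+1%:Z - 2))%:P
     - (2 * a (2 * j.+1%:Z - i.+1%:Z - 1))%:P * 'X).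
have -> : (- ((2 * a 0)%:P * 'X)%:P - 'X) * detU (shift_decim n) = detU N.
  rewrite [RHS]detU_col0 => [|i]; rewrite !mxE /=; last first.
    rewrite /bump /= !a_lt0 ?mulr0 ?mul0r ?subr0 //; lia.
  rewrite (a_lt0 (2 * 1 - 1 - 2)) // polyC0 sub0r polyCN.
  congr (_ * detU _); apply/matrixP => i j; rewrite !mxE /= /bump /=.
  by congr ((a _)%:P - (2 * a _)%:P * 'X); lia.
apply: cmod_det => i j; rewrite !mxE.
exists ((a (2 * j.+1%:Z - i.+1%:Z))%:P)%:P.
by rewrite -polyCM !polyCD !polyCN !polyCM; ring.
Qed.

(** In (-2 a_0 t - U) det (P - U) the coefficient of U t is -2 a_0 times that of U t^0 in det (P -
    U), minus that of U^0 t. These two are [P1] and [P0]. *)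
Lemma coef11_detU_M2 n :
  - (detU (M2_gen n.+2))`_1`_1 =
  2 * a 0 ^+ 2 * (detU (decim n))`_1
  - 2 * (a 0 + a 1) * (detU (decim n))`_0.
Proof.
rewrite (@coef_cmodCXn _ 2 1 1 _ _ isT (detU_M2_mod n.+1)).
have P1 : (detU (shift_decim n.+1))`_1`_0 =
    a 0 * (detU (decim n))`_1 - (detU (decim n))`_0.
  rewrite -horner_coef0 -[LHS]/(horner_eval 0 _) -coef_map detU_shift_decim0.
  by rewrite mulrBl coefB coefCM coefXM.
have P0 : (detU (shift_decim n.+1))`_0`_1 = - (2 * a 1 * (detU (decim n))`_0).
  rewrite detU_coef0 (@coef_cmodXn _ 2 1 _ _ isT (det_shift_decim_mod n)).
  by rewrite detU_coef0 coefMC coefB coefC coefCM coefX mulr1 sub0r mulNr.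
rewrite mulrBl mulNr coefB coefN coefCM coefXM /= coefB coefN.
rewrite -[_ * 'X * _]mulrA coefCM.
by rewrite coefXM /= P1 P0; ring.
Qed.

End Decimation.

Theorem theorem3p1 (m : nat) (hm : (1 <= m)%N) :
  H2 m 1 1 =
    - 2 * avar m 0 ^+ 2 * D m 1 - 2 * (avar m 0 + avar m 1) * D m 0.
Proof.
case: m hm => // n _.
have := @coef11_detU_M2 _ (avar n.+1) (fun=> erefl) n.
(* The sign (-1)^1 inside [D m 1] produces the minus in front of 2 a_0^2. *)
rewrite /H2 /D expr1 expr0 mulN1r mul1r => E.
transitivity (- (detU (M2_gen _ (avar n.+1) n.+2))`_1`_1); first by [].
rewrite E -[M0 n.+1]/(decim _ (avar n.+1) n); ring.
Qed.
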